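(* Let $A\in\mathbb{H}^{m\times n}$. Then the Moore--Penrose inverse $A^\dagger$ of $A$ is given by $$A^{\dagger}=A^{(2)}_{l,(A^*,A^* )}=A^{(2)}_{r,(A^*,A^* )}=A^*(A^*AA^* )^{(1)}A^*,$$ where $(A^*AA^* )^{(1)}$ is any $\{1\}$-inverse of $A^*AA^*$.
   Context: $\mathbb{H}$ denotes the real quaternions; $A^*$ is the conjugate transpose of a quaternion matrix $A$. For $B\in\mathbb{H}^{m\times n}$: $\mathcal{R}_r(B)=\{Bx : x\in\mathbb{H}^{n\times 1}\}$, $\mathcal{N}_r(B)=\{x\in\mathbb{H}^{n\times 1} : Bx=0\}$, $\mathcal{R}_l(B)=\{xB : x\in\mathbb{H}^{1\times m}\}$, $\mathcal{N}_l(B)=\{x\in\mathbb{H}^{1\times m} : xB=0\}$. A $\{1\}$-inverse of $B\in\mathbb{H}^{m\times n}$ is any $Y\in\mathbb{H}^{n\times m}$ with $BYB=B$. The Moore--Penrose inverse $A^\dagger\in\mathbb{H}^{n\times m}$ is the unique $X$ with $AXA=A$, $XAX=X$, $(AX)^*=AX$, $(XA)^*=XA$. For matrices $S,T$ of suitable sizes, $A^{(2)}_{r,(S,T)}$ denotes the matrix $X\in\mathbb{H}^{n\times m}$ with $XAX=X$, $\mathcal{R}_r(X)=\mathcal{R}_r(S)$, $\mathcal{N}_r(X)=\mathcal{N}_r(T)$; and $A^{(2)}_{l,(S,T)}$ denotes the matrix $X\in\mathbb{H}^{n\times m}$ with $XAX=X$, $\mathcal{R}_l(X)=\mathcal{R}_l(S)$,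 $\mathcal{N}_l(X)=\mathcal{N}_l(T)$ (each is unique when it exists). *)

(* Defs.v *)
From HB Require Import structures.
From mathcomp Require Import all_boot all_order all_algebra.
From mathcomp Require Import boolp classical_sets reals.
From mathcomp Require Import ring.

Set Implicit Arguments.
Unset Strict Implicit.
Unset Printing Implicit Defensive.

Import GRing.Theory.
Local Open Scope classical_set_scope.
Local Open Scope ring_scope.

(* [Quat a b c d] is a + b i + c j + d k. *)
Record quat (R : Type) : Type := Quat { q1 : R; qi : R; qj : R; qk : R }.

Section QuatChoice.
Variable R : Type.

Definition seq_of_quat (x : quat R) := [:: q1 x; qi x; qj x; qk x].
Definition quat_of_seq (s : seq R) :=
  if s is [:: a; b; c; d] then Some (Quat a b c d) else None.

Lemma seq_of_quatK : pcancel seq_of_quat quat_of_seq.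
Proof. by case. Qed.

End QuatChoice.

HB.instance Definition _ (R : eqType) := Equality.copy (quat R)
  (pcan_type (@seq_of_quatK R)).
HB.instance Definition _ (R : choiceType) := Choice.copy (quat R)
  (pcan_type (@seq_of_quatK R)).

Section QuatZmodule.
Variable R : zmodType.

Definition addq (x y : quat R) :=
  let: Quat a b c d := x in let: Quat a' b' c' d' := y in
  Quat (a + a') (b + b') (c + c') (d + d').
Definition oppq (x : quat R) :=
  let: Quat a b c d := x in Quat (- a) (- b) (- c) (- d).

Lemma addqA : associative addq.
Proof. by move=> [? ? ? ?] [? ? ? ?] [? ? ? ?] /=; rewrite !addrA. Qed.

Lemma addqC : commutative addq.
Proof. by move=> [? ? ? ?] [? ? ? ?] /=; congr Quat; rewrite addrC. Qed.

Lemma add0q : left_id (Quat 0 0 0 0) addq.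
Proof. by move=> [? ? ? ?] /=; rewrite !add0r. Qed.

Lemma addNq : left_inverse (Quat 0 0 0 0) oppq addq.
Proof. by move=> [? ? ? ?] /=; rewrite !addNr. Qed.

HB.instance Definition _ :=
  GRing.isZmodule.Build (quat R) addqA addqC add0q addNq.

End QuatZmodule.

Section QuatRing.
Variable R : comNzRingType.

Definition mulq (x y : quat R) :=
  let: Quat a b c d := x in let: Quat a' b' c' d' := y in
  Quat (a * a' - b * b' - c * c' - d * d')
       (a * b' + b * a' + c * d' - d * c')
       (a * c' - b * d' + c * a' + d * b')
       (a * d' + b * c' - c * b' + d * a').

Lemma mulqA : associative mulq.
Proof. by move=> [? ? ? ?] [? ? ? ?] [? ? ? ?] /=; congr Quat; ring. Qed.

Lemma mul1q : left_id (Quat 1 0 0 0) mulq.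
Proof. by move=> [? ? ? ?] /=; congr Quat; ring. Qed.

Lemma mulq1 : right_id (Quat 1 0 0 0) mulq.
Proof. by move=> [? ? ? ?] /=; congr Quat; ring. Qed.

Lemma mulqDl : left_distributive mulq (@addq R).
Proof. by move=> [? ? ? ?] [? ? ? ?] [? ? ? ?] /=; congr Quat; ring. Qed.

Lemma mulqDr : right_distributive mulq (@addq R).
Proof. by move=> [? ? ? ?] [? ? ? ?] [? ? ? ?] /=; congr Quat; ring. Qed.

Lemma oneq_neq0 : Quat 1 0 0 0 != 0 :> quat R.
Proof. by apply/eqP => -[] /eqP; rewrite oner_eq0. Qed.

HB.instance Definition _ := GRing.Zmodule_isNzRing.Build (quat R)
  mulqA mul1q mulq1 mulqDl mulqDr oneq_neq0.

Definition conjq (x : quat R) :=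
  let: Quat a b c d := x in Quat a (- b) (- c) (- d).

End QuatRing.

Section QuatMatrix.
Variable R : comNzRingType.
Local Notation H := (quat R).

Definition ctrmx m n (A : 'M[H]_(m, n)) : 'M[H]_(n, m) :=
  map_mx (@conjq R) A^T.

Definition range_r m n (B : 'M[H]_(m, n)) : set 'cV[H]_m :=
  [set B *m x | x in [set: 'cV[H]_n]].
Definition null_r m n (B : 'M[H]_(m, n)) : set 'cV[H]_n :=
  [set x | B *m x = 0].
Definition range_l m n (B : 'M[H]_(m, n)) : set 'rV[H]_n :=
  [set x *m B | x in [set: 'rV[H]_m]].
Definition null_l m n (B : 'M[H]_(m, n)) : set 'rV[H]_m :=
  [set x | x *m B = 0].

Definition is_inner_inverse m n (B : 'M[H]_(m, n)) (Y : 'M[H]_(n, m)) :=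
  B *m Y *m B = B.

Definition is_moore_penrose m n (A : 'M[H]_(m, n)) (X : 'M[H]_(n, m)) :=
  [/\ A *m X *m A = A, X *m A *m X = X,
      ctrmx (A *m X) = A *m X & ctrmx (X *m A) = X *m A].

Definition is_outer_inverse_r m n p q (A : 'M[H]_(m, n))
    (S : 'M[H]_(n, p)) (T : 'M[H]_(q, m)) (X : 'M[H]_(n, m)) :=
  [/\ X *m A *m X = X, range_r X = range_r S & null_r X = null_r T].

Definition is_outer_inverse_l m n p q (A : 'M[H]_(m, n))
    (S : 'M[H]_(p, m)) (T : 'M[H]_(n, q)) (X : 'M[H]_(n, m)) :=
  [/\ X *m A *m X = X, range_l X = range_l S & null_l X = null_l T].

End QuatMatrix.

(* Main.v *)
Require Import Defs.
From mathcomp Require Import all_boot all_order all_algebra.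
From mathcomp Require Import boolp classical_sets reals.
From mathcomp Require Import ring.

(** Rank-one elimination gives inner inverses over any division ring.
    Positivity of the quaternion norm makes [A^*] cancellable:
    [A^* A B = 0] forces [A B = 0].  Hence, for any inner inverse [Y] of
    [A^* A A^*], the matrix [X = A^* Y A^*] satisfies [X A A^* = A^*] and
    [A^* A X = A^*], from which the four Penrose equations follow.  Every
    Moore-Penrose inverse is an outer inverse with the range and null space
    of [A^*], and an outer inverse is determined by its range and null space. *)

Set Implicit Arguments.
Unset Strict Implicit.
Unset Printing Implicit Defensive.

Import GRing.Theory Num.Theory.
Local Open Scope classical_set_scope.
Local Open Scope ring_scope.

(** * Inner inverses over a division ring *)

(** Since [B] is both [A (1 - Z A)] and [(1 - A Z) A], the correction to [Z] contributes
    [B Y B = B], exactly what [A Z A] misses of [A]. *)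
Lemma inner_inverse_reduce (K : nzRingType) m n (A : 'M[K]_(m, n)) Z Y :
  let B := A - A *m Z *m A in
  B *m Y *m B = B ->
  A *m (Z + (1%:M - Z *m A) *m Y *m (1%:M - A *m Z)) *m A = A.
Proof.
move=> B BYB.
have BQ : B = A *m (1%:M - Z *m A) by rewrite mulmxBr mulmx1 mulmxA.
have BP : B = (1%:M - A *m Z) *m A by rewrite mulmxBl mul1mx.
rewrite mulmxDr mulmxDl !mulmxA -BQ -(mulmxA (B *m Y)) -BP BYB.
by rewrite /B addrC subrK.
Qed.

(** Induction on the number of nonzero rows: eliminating with a nonzero pivot lowers it. *)
Lemma inner_inverse_exists (K : nzRingType)
    (inv : forall x : K, x != 0 -> exists y, x * y = 1)
    m n (A : 'M[K]_(m, n)) :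
  exists Y : 'M[K]_(n, m), A *m Y *m A = A.
Proof.
have [N] := ubnP #|[pred k | row k A != 0]|; elim: N A => // N IH A ltN.
have [A0|[i [j Aij0]]] : A = 0 \/ exists i j, A i j != 0.
- have [/existsP[i /existsP[j Aij]]|/existsPn A0] :=
    boolP [exists i, [exists j, A i j != 0]]; first by right; exists i, j.
  left; apply/matrixP => i j; rewrite mxE.
  by have /existsPn/(_ j)/negPn/eqP := A0 i.
- by exists 0; rewrite A0 !mul0mx.
have [b ab1] := inv _ Aij0.
(* [Z] has the single entry [b] at [(j, i)]; the factored form makes [A Z A] column [j] of [A],
   times [b], times row [i]. *)
pose Z := delta_mx j (0 : 'I_1) *m b%:M *m delta_mx (0 : 'I_1) i.
have rowZ k : row k (A - A *m Z *m A) = row k A - (A k j * b) *: row i A.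
  rewrite /Z !mulmxA -colE -(mulmxA _ (delta_mx _ _)) -rowE; apply/rowP => l.
  by rewrite !mxE big_ord1 !mxE big_ord1 !mxE.
have [|Y BYB] := IH (A - A *m Z *m A).
  rewrite -ltnS; apply: leq_trans ltN; rewrite ltnS.
  (* Zero rows stay zero, and the pivot row [i] becomes zero because [A i j * b = 1]. *)
  apply/proper_card/properP; split.
    apply/fintype.subsetP => k; rewrite !inE rowZ; apply: contra => /eqP Ak0.
    have -> : A k j = 0 by move/rowP/(_ j): Ak0; rewrite !mxE.
    by rewrite Ak0 mul0r scale0r subr0.
  exists i; rewrite !inE.
    by apply: contra Aij0 => /eqP/rowP/(_ j); rewrite !mxE => ->.
  by rewrite rowZ ab1 scale1r subrr eqxx.
by eexists; apply: inner_inverse_reduce BYB.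
Qed.

(** * Conjugate transposition *)

Section Conjugate.
Variable R : comNzRingType.
Implicit Types x y : quat R.

Lemma conjqK : involutive (@conjq R).
Proof. by move=> [a b c d] /=; rewrite !opprK. Qed.

Lemma conjqD x y : conjq (x + y) = conjq x + conjq y.
Proof. by case: x y => [? ? ? ?] [? ? ? ?]; congr Quat; ring. Qed.

Lemma conjqM x y : conjq (x * y) = conjq y * conjq x.
Proof. by case: x y => [? ? ? ?] [? ? ? ?]; congr Quat; ring. Qed.

Lemma conjq0 : conjq 0 = 0 :> quat R.
Proof. by congr Quat; rewrite oppr0. Qed.

Lemma ctrmxK m n (A : 'M[quat R]_(m, n)) : ctrmx (ctrmx A) = A.
Proof. by apply/matrixP => i j; rewrite !mxE conjqK. Qed.

Lemma ctrmx_mul m n p (A : 'M[quat R]_(m, n)) (B : 'M_(n, p)) :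
  ctrmx (A *m B) = ctrmx B *m ctrmx A.
Proof.
apply/matrixP => i j; rewrite !mxE (big_morph _ conjqD conjq0).
by apply: eq_bigr => k _; rewrite !mxE conjqM.
Qed.

End Conjugate.

(** * Positivity of the norm, cancellation and the Penrose equations *)

Section Positivity.
Variable R : realFieldType.

Definition normsq (x : quat R) : R :=
  q1 x ^+ 2 + qi x ^+ 2 + qj x ^+ 2 + qk x ^+ 2.

Lemma normsq_ge0 x : 0 <= normsq x.
Proof. by rewrite /normsq !addr_ge0 ?sqr_ge0. Qed.

Lemma normsq_eq0 x : normsq x = 0 -> x = 0.
Proof.
case: x => a b c d /eqP; rewrite /normsq /=.
rewrite !paddr_eq0 ?addr_ge0 ?sqr_ge0 // !sqrf_eq0.
by move=> /andP[/andP[/andP[/eqP-> /eqP->] /eqP->] /eqP->].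
Qed.

Lemma q1_mul_conjq x : q1 (conjq x * x) = normsq x.
Proof. by case: x => a b c d; rewrite /normsq /=; ring. Qed.

Lemma quat_inv (x : quat R) : x != 0 -> exists y, x * y = 1.
Proof.
move=> x0; have : normsq x != 0 by apply: contra x0 => /eqP/normsq_eq0->.
case: x {x0} => a b c d; rewrite /normsq /= => N0.
pose N := a ^+ 2 + b ^+ 2 + c ^+ 2 + d ^+ 2.
(* The inverse is the conjugate divided by the squared norm. *)
by exists (Quat (a / N) (- b / N) (- c / N) (- d / N));
  congr Quat; rewrite /N; field.
Qed.

(** The real part of the [j]-th diagonal entry of the product is the sum of the squared norms in
    column [j] of [A]. *)
Lemma ctrmx_mul_eq0 m n (A : 'M[quat R]_(m, n)) : ctrmx A *m A = 0 -> A = 0.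
Proof.
move=> AA0; apply/matrixP => i j; rewrite mxE.
have q1D : {morph @q1 R : x y / x + y} by case=> ? ? ? ? [].
have /(congr1 (@q1 R)) : (ctrmx A *m A) j j = 0 by rewrite AA0 mxE.
rewrite mxE (big_morph _ q1D (erefl : q1 (0 : quat R) = 0)) => /eqP.
under eq_bigr do rewrite !mxE q1_mul_conjq.
rewrite psumr_eq0 => [|k _]; last exact: normsq_ge0.
by move=> /allP/(_ i (mem_index_enum _))/eqP/normsq_eq0.
Qed.

(** With [D = B - C], the product [ctrmx (A D) *m (A D)] contains the factor
    [ctrmx A *m A *m D = 0]. *)
Lemma ctrmx_cancel m n p (A : 'M[quat R]_(m, n)) (B C : 'M_(n, p)) :
  ctrmx A *m A *m B = ctrmx A *m A *m C -> A *m B = A *m C.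
Proof.
move=> /eqP; rewrite -subr_eq0 -mulmxBr => /eqP AAD0.
apply/eqP; rewrite -subr_eq0 -mulmxBr; apply/eqP/ctrmx_mul_eq0.
by rewrite ctrmx_mul -mulmxA (mulmxA (ctrmx A)) AAD0 mulmx0.
Qed.

Lemma ctrmx_cancelr m n p (A : 'M[quat R]_(m, n)) (B C : 'M_(p, m)) :
  B *m A *m ctrmx A = C *m A *m ctrmx A -> B *m A = C *m A.
Proof.
move=> /(congr1 (@ctrmx R _ _)); rewrite !ctrmx_mul !ctrmxK => BC.
apply: (can_inj (@ctrmxK R _ _)); rewrite !ctrmx_mul.
by apply: ctrmx_cancel; rewrite ctrmxK -!mulmxA.
Qed.

Lemma inner_inverse_moore_penrose m n (A : 'M[quat R]_(m, n)) Y :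
  is_inner_inverse (ctrmx A *m A *m ctrmx A) Y ->
  is_moore_penrose A (ctrmx A *m Y *m ctrmx A).
Proof.
rewrite /is_inner_inverse; set S := ctrmx A => MYM; set X := S *m Y *m S.
have SK : ctrmx S = A by apply: ctrmxK.
(* [MYM] reads [S A (X A S) = S A S]. Cancelling [S = ctrmx A] on the left gives [A X A S = A S];
   cancelling [A = ctrmx S] then gives the claim. [SAX] is the mirror image. *)
have XAS : X *m A *m S = S.
  have /ctrmx_cancel AXAS : S *m A *m (X *m A *m S) = S *m A *m S.
    by rewrite /X !mulmxA in MYM *.
  have := @ctrmx_cancel _ _ _ S (Y *m S *m A *m S) 1%:M.
  by rewrite /X SK !mulmx1 !mulmxA in AXAS *; apply.
have SAX : S *m A *m X = S.
  have /ctrmx_cancelr SAXA : S *m A *m X *m A *m S = S *m A *m S.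
    by rewrite /X !mulmxA in MYM *.
  have := @ctrmx_cancelr _ _ _ S (S *m A *m S *m Y) 1%:M.
  by rewrite /X SK !mul1mx !mulmxA in SAXA *; apply.
have [defX defS] : X = S *m Y *m S /\ ctrmx A = S by [].
clearbody X S; split.
- have := @ctrmx_cancelr _ _ _ A (A *m X) 1%:M; rewrite mul1mx; apply.
  by rewrite defS -!mulmxA (mulmxA X) XAS.
- by rewrite {1}defX -!mulmxA (mulmxA S A) SAX mulmxA -defX.
(* By [SAX], [ctrmx (A X)] equals [ctrmx (A X) *m (A X)], which is visibly Hermitian; [X A] is
   treated likewise through [XAS]. *)
- have E : ctrmx (A *m X) = ctrmx X *m S *m A *m X.
    by rewrite ctrmx_mul defS -!mulmxA (mulmxA S) SAX.
  by rewrite -[RHS]ctrmxK E !ctrmx_mul ctrmxK SK defS !mulmxA.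
- have E : ctrmx (X *m A) = X *m A *m S *m ctrmx X.
    by rewrite ctrmx_mul defS XAS.
  by rewrite -[RHS]ctrmxK E !ctrmx_mul ctrmxK SK defS !mulmxA.
Qed.

End Positivity.

(** * Outer inverses with prescribed range and null space *)

Section OuterInverse.
Variable R : comNzRingType.

Lemma mulmx_inj_cV m n (B C : 'M[quat R]_(m, n)) :
  (forall x : 'cV_n, B *m x = C *m x) -> B = C.
Proof.
move=> BC; apply/matrixP => i j.
by have /colP/(_ i) := BC (delta_mx j 0); rewrite -!colE !mxE.
Qed.

Lemma mulmx_inj_rV m n (B C : 'M[quat R]_(m, n)) :
  (forall x : 'rV_m, x *m B = x *m C) -> B = C.
Proof. by move=> BC; apply/row_matrixP => i; rewrite !rowE. Qed.

(** The vector [A X2 x - x] is killed by [X2], hence by [X1], so [X1 A X2 = X1]; and [X1 A] fixes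
    the range of [X1], which contains [X2 x], so [X1 A X2 = X2]. *)
Lemma outer_inverse_r_unique m n p q (A : 'M[quat R]_(m, n))
    (S : 'M_(n, p)) (T : 'M_(q, m)) X1 X2 :
  is_outer_inverse_r A S T X1 -> is_outer_inverse_r A S T X2 -> X1 = X2.
Proof.
move=> [XAX1 R1 N1] [XAX2 R2 N2]; transitivity (X1 *m A *m X2).
  apply: mulmx_inj_cV => x.
  have : null_r X2 (A *m (X2 *m x) - x).
    by rewrite /null_r /= mulmxBr !mulmxA XAX2 subrr.
  rewrite N2 -N1 /null_r /= mulmxBr !mulmxA => /eqP.
  by rewrite subr_eq0 => /eqP.
apply: mulmx_inj_cV => x.
have : range_r X2 (X2 *m x) by exists x.
by rewrite R2 -R1 => -[y _ X1y]; rewrite -mulmxA -X1y mulmxA XAX1.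
Qed.

(** On row vectors the roles swap: equal ranges give [X1 A X2 = X1], equal null spaces give
    [X1 A X2 = X2]. *)
Lemma outer_inverse_l_unique m n p q (A : 'M[quat R]_(m, n))
    (S : 'M_(p, m)) (T : 'M_(n, q)) X1 X2 :
  is_outer_inverse_l A S T X1 -> is_outer_inverse_l A S T X2 -> X1 = X2.
Proof.
move=> [XAX1 R1 N1] [XAX2 R2 N2]; transitivity (X1 *m A *m X2).
  apply: mulmx_inj_rV => x.
  have : range_l X1 (x *m X1) by exists x.
  rewrite R1 -R2 => -[y _ X2y].
  by rewrite !mulmxA -X2y -!mulmxA (mulmxA X2) XAX2.
apply: mulmx_inj_rV => x.
have : null_l X1 (x *m X1 *m A - x).
  by rewrite /null_l /= mulmxBl -!mulmxA (mulmxA X1) XAX1 subrr.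
rewrite N1 -N2 /null_l /= mulmxBl !mulmxA => /eqP.
by rewrite subr_eq0 => /eqP.
Qed.

Variables (m n : nat) (A : 'M[quat R]_(m, n)) (X : 'M[quat R]_(n, m)).
Hypothesis AX : is_moore_penrose A X.

(** [ctrmx A] and [X] are multiples of each other on both sides, so their left and right ranges and
    null spaces coincide. *)
Lemma moore_penrose_factors :
  [/\ ctrmx A = X *m A *m ctrmx A, ctrmx A = ctrmx A *m A *m X,
      X = ctrmx A *m ctrmx X *m X & X = X *m ctrmx X *m ctrmx A].
Proof.
case: AX => AXA XAX hAX hXA; split.
- by rewrite -hXA -ctrmx_mul mulmxA AXA.
- by rewrite -mulmxA -hAX -ctrmx_mul AXA.
- by rewrite -ctrmx_mul hXA XAX.
- by rewrite -mulmxA -ctrmx_mul hAX mulmxA XAX.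
Qed.

Lemma moore_penrose_outer_r : is_outer_inverse_r A (ctrmx A) (ctrmx A) X.
Proof.
have [S1 S2 X1 X2] := moore_penrose_factors.
split; first by case: AX.
  apply/seteqP; split => _ [x _ <-].
    by exists (ctrmx X *m X *m x) => //; rewrite [in RHS]X1 !mulmxA.
  by exists (A *m ctrmx A *m x) => //; rewrite [in RHS]S1 !mulmxA.
apply/seteqP; split => x /= x0; rewrite /null_r /=.
  by rewrite S2 -mulmxA x0 mulmx0.
by rewrite X2 -mulmxA x0 mulmx0.
Qed.

Lemma moore_penrose_outer_l : is_outer_inverse_l A (ctrmx A) (ctrmx A) X.
Proof.
have [S1 S2 X1 X2] := moore_penrose_factors.
split; first by case: AX.
  apply/seteqP; split => _ [x _ <-].
    by exists (x *m (X *m ctrmx X)) => //; rewrite [in RHS]X2 !mulmxA.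
  by exists (x *m (ctrmx A *m A)) => //; rewrite [in RHS]S2 !mulmxA.
apply/seteqP; split => x /= x0; rewrite /null_l /=.
  by rewrite S1 !mulmxA x0 !mul0mx.
by rewrite X1 !mulmxA x0 !mul0mx.
Qed.

End OuterInverse.

Theorem theorem4p6 (R : realType) (m n : nat) (A : 'M[quat R]_(m, n)) :
  exists Adag : 'M[quat R]_(n, m),
    [/\ unique (is_moore_penrose A) Adag,
        unique (is_outer_inverse_l A (ctrmx A) (ctrmx A)) Adag,
        unique (is_outer_inverse_r A (ctrmx A) (ctrmx A)) Adag,
        (exists Y : 'M[quat R]_(m, n),
           is_inner_inverse (ctrmx A *m A *m ctrmx A) Y) &
        forall Y : 'M[quat R]_(m, n),
          is_inner_inverse (ctrmx A *m A *m ctrmx A) Y ->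
          Adag = ctrmx A *m Y *m ctrmx A].
Proof.
have [Y MYM] :=
  @inner_inverse_exists _ (@quat_inv R) _ _ (ctrmx A *m A *m ctrmx A).
have AX := @inner_inverse_moore_penrose R _ _ A Y MYM.
(* Uniqueness is inherited from outer inverses; it also shows that the formula does not depend on
   the choice of [Y]. *)
have MP_unique X : is_moore_penrose A X -> ctrmx A *m Y *m ctrmx A = X.
  move/moore_penrose_outer_r.
  exact/outer_inverse_r_unique/moore_penrose_outer_r.
exists (ctrmx A *m Y *m ctrmx A); split.
- by split.
- split=> [|X]; first exact: moore_penrose_outer_l.
  exact/outer_inverse_l_unique/moore_penrose_outer_l.
- split=> [|X]; first exact: moore_penrose_outer_r.
  exact/outer_inverse_r_unique/moore_penrose_outer_r.
- by exists Y.
- by move=> Y' /inner_inverse_moore_penrose/MP_unique.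
Qed.
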